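(* Let $\{X_n\}$ be a sequence of random variables whose probability generating functions $\mathbb{E}(z^{X_n})$ are polynomials with only roots of modulus one, and let $X_n^* := (X_n-\mathbb{E}(X_n))/\sqrt{\mathbb{V}(X_n)}$. If the sequence $\{X_n^*\}$ converges in distribution to some limit distribution $X$, then the moment generating function of $X$ is finite and has the infinite-product representation $$\mathbb{E}(e^{Xs})=e^{qs^2/2}\prod_{k\ge1}\left(1+\frac{q_k}{2}\,s^2\right),$$ where $q$ and the members of the sequence $\{q_k\}_{k\ge1}$ are all non-negative numbers such that $$q+\sum_{k\ge1}q_k=1 .$$
   Context: $\mathbb{V}$ denotes variance. The random variables $X_n$ take finitely many non-negative integer values, and the polynomials are non-constant with nonzero variance $\mathbb{V}(X_n)>0$, so that $X_n^*$ is defined. *)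

(* Defs.v *)
From HB Require Import structures.
From mathcomp Require Export all_boot all_order all_algebra.
From mathcomp Require Export complex.
From mathcomp Require Export all_classical all_reals all_analysis.

Export Order.TTheory GRing.Theory Num.Theory.
Export numFieldNormedType.Exports.

Set Implicit Arguments.
Unset Strict Implicit.
Unset Printing Implicit Defensive.

#[export] Set Implicit Arguments.
#[export] Unset Strict Implicit.
#[export] Unset Printing Implicit Defensive.

Local Open Scope classical_set_scope.
Local Open Scope ring_scope.

(* [fine] is harmless on variables taking finitely many values, whose
   expectations are finite. *)
Definition complex_expectation d (T : measurableType d) (R : realType)
    (P : probability T R) (Z : T -> R[i]) : R[i] :=
  Complex (fine 'E_P[fun w => complex.Re (Z w)]%E)
          (fine 'E_P[fun w => complex.Im (Z w)]%E).

Definition pgf d (T : measurableType d) (R : realType)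
    (P : probability T R) (X : T -> nat) (z : R[i]) : R[i] :=
  complex_expectation P (fun w => z ^+ X w).

Definition real_of_nat_rv d (T : measurableType d) (R : realType)
    (X : T -> nat) : T -> R := fun w => (X w)%:R.

(* Meaningful when X has finite mean and finite nonzero variance. *)
Definition standardized d (T : measurableType d) (R : realType)
    (P : probability T R) (X : T -> R) : T -> R :=
  fun w => (X w - fine 'E_P[X]%E) / Num.sqrt (fine 'V_P[X]%E).

(* The variables may live on different probability spaces. *)
Definition cvg_in_distribution (R : realType)
    (d : nat -> measure_display) (T : forall n, measurableType (d n))
    (P : forall n, probability (T n) R) (X : forall n, T n -> R)
    (d' : measure_display) (T' : measurableType d')
    (P' : probability T' R) (Y : T' -> R) : Prop :=
  forall f : R -> R, continuous f -> bounded_fun f ->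
    ('E_(P n)[f \o X n] @[n --> \oo] --> 'E_P'[f \o Y])%E.

(* Main.v *)
Require Import Defs.
From mathcomp Require Import measurable_realfun ring lra.

Local Open Scope classical_set_scope.
Local Open Scope ring_scope.

(** Let [r] be the probability generating function of one of the variables
[X], a real polynomial, and [X'] the standardized variable.  Replacing [X] by
[2m X] does not change [X'] and replaces [r] by [r \Po 'X^(2m)], whose roots still
have modulus one; none of them is real, since [-1] and [1] would both force
[r] to vanish at [1].  The roots therefore come in conjugate pairs, and a
pair of real part [c] contributes the factor
  [('X^2 - 2 c 'X + 1) / (2 - 2 c) = 'X + (a / 2) ('X - 1)^2]
with [a = 1 / (1 - c) >= 0] ([dilated_pgf_factor]).  At [x = exp h] this
factor is [x (1 + a (cosh h - 1))], and comparing the first two derivatives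
at [1] shows that the number of factors is the mean of [2m X] and that the
sum [S] of the [a] is its variance.  Hence ([standardized_mgf_factor])
  [E (exp (t X')) = \prod_a (1 + a (cosh (t / sqrt S) - 1))],
and with the weights [b = a / S], which are nonnegative and sum to [1],
each factor is [1 + b w] where [w = S (cosh (t / sqrt S) - 1)].  Since [m] is
free, it can be chosen so large that [S >= n + 1] for the [n]-th variable;
then [w] tends to [t^2 / 2] as [n] grows ([cvg_cosh_scaled]), whether or not
the variances of the given variables are bounded.

Sort the weights of the [n]-th variable in decreasing order, so that the one
of index [k] is at most [1 / (k + 1)], and fix an ultrafilter [F] finer than
the filter of neighborhoods of infinity.  By compactness every weight
converges along [F], say to [beta k], and the sum of the [beta k] is some
[1 - q] with [q >= 0].  Cut the product at index [K].  By
[exp (y / (1 + c)) <= 1 + y <= exp y] for [0 <= y <= c], the part beyond [K]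
is the exponential of [w] times the remaining mass, up to a factor [1 + O (1/K)]
in the exponent.  Letting [n] go along [F] and then [K] go to infinity, the
moment generating functions converge along [F] to
  [exp (q t^2 / 2) \prod_k (1 + beta k t^2 / 2)] ([limit_product]);
the escaping mass [q] is what produces the Gaussian factor.

Finally, the moment generating functions at [2t] are bounded, so the
variables [exp (t X')] are uniformly integrable and their expectations
converge along [F] to [E (exp (t Y))] ([mgf_limit]), which identifies the two
limits. *)

(** * Real polynomials whose roots are nonreal of modulus one *)

(** A root [a + i b] makes ['X^2 - 2 a 'X + 1] divide [q]: the remainder has
degree at most one and a nonreal root, hence vanishes.  Dividing this
quadratic by its value [2 (1 - a)] at [1] gives a factor of the stated
shape. *)
Lemma unit_nonreal_roots_factor (R : rcfType) (q : {poly R}) :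
  q.[1] = 1 ->
  (forall z : R[i], root (map_poly (real_complex R) q) z ->
     `|z| = 1 /\ complex.Im z != 0) ->
  exists2 s : seq R, {in s, forall a, 0 <= a} &
    q = \prod_(a <- s) ('X + (a / 2) *: ('X - 1) ^+ 2).
Proof.
have [n] := ubnP (size q).
elim: n q => // n IH q sq q1 rootq.
have [q_cst|q_big] := leqP (size q) 1.
  exists [::] => //; rewrite big_nil [LHS]size1_polyC//.
  by move: q1; rewrite {1}(size1_polyC q_cst) hornerC => ->; rewrite polyC1.
have /closed_rootP[z rz] : size (map_poly (real_complex R) q) != 1%N.
  by rewrite size_map_poly neq_ltn q_big orbT.
case: (rootq _ rz) => nz /=; case: z nz rz => a b nz rz /= b0.
have ab1 : a ^+ 2 + b ^+ 2 = 1.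
  by have := add_Re2_Im2 (Complex a b); rewrite nz expr1n /= => -[].
have a1 : 0 < 1 - a.
  have : 0 < b ^+ 2 by rewrite exprn_even_gt0.
  by nra.
pose f : {poly R} := 'X ^+ 2 + ((- (2 * a)) *: 'X + 1).
have sf : size f = 3%N.
  rewrite /f size_polyDl size_polyXn//.
  by rewrite (leq_ltn_trans (size_polyD _ _))// gtn_max size_poly1
    (leq_ltn_trans (size_scale_leq _ _))// size_polyX.
have f0 : f != 0 by rewrite -size_poly_eq0 sf.
have fz : (map_poly (real_complex R) f).[Complex a b] = 0.
  rewrite /f !rmorphD rmorphXn /= map_polyX linearZ /= map_polyX rmorph1.
  rewrite !hornerE /= expr2; apply/eqP; rewrite eq_complex /=.
  by apply/andP; split; apply/eqP; [rewrite -[X in _ + X]ab1; ring|ring].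
(* The remainder [u + v X] vanishes at [a + i b] with [b != 0]. *)
have qf0 : q %% f = 0.
  set r := q %% f.
  have sr : (size r <= 2)%N by rewrite -ltnS -sf ltn_modp.
  have rE : r = (r`_0)%:P + r`_1 *: 'X.
    apply/polyP => i; rewrite !coefE.
    case: i => [|[|i]] /=; rewrite ?mulr0 ?addr0 ?mulr1 ?add0r//.
    by rewrite nth_default// (leq_trans sr).
  have : (map_poly (real_complex R) r).[Complex a b] = 0.
    move: rz; rewrite {1}(divp_eq q f) -/r rmorphD rmorphM /= => /rootP.
    by rewrite hornerD hornerM fz mulr0 add0r.
  rewrite rE rmorphD /= map_polyZ map_polyC map_polyX !hornerE /= => /eqP.
  rewrite eq_complex /= mul0r subr0 add0r => /andP[/eqP e1].
  rewrite mul0r addr0 mulf_eq0 (negbTE b0) orbF => /eqP r1.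
  by move: e1; rewrite r1 mul0r addr0 => ->; rewrite scale0r addr0.
have qE : q = (q %/ f) * f by rewrite {1}(divp_eq q f) qf0 addr0.
have f1 : f.[1] = 2 * (1 - a) by rewrite /f !hornerE /=; ring.
have c0 : 2 * (1 - a) != 0 by rewrite mulf_neq0// gt_eqF.
pose g := (2 * (1 - a)) *: (q %/ f).
have qg : q = ('X + ((1 - a)^-1 / 2) *: ('X - 1) ^+ 2) * g.
  rewrite {1}qE /g -scalerAr mulrC scalerAl; congr (_ * _).
  rewrite scalerDr scalerA -mul_polyC -mul_polyC.
  have -> : 2 * (1 - a) * ((1 - a)^-1 / 2) = 1 by field; rewrite gt_eqF.
  rewrite /f -mul_polyC !(polyCM, polyCB, polyCN, polyC1).
  rewrite [2]/(1 + 1) polyCD polyC1; by ring.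
have [|||s s0 gE] := IH g.
- have g0 : q %/ f != 0.
    by apply: contraTneq q_big => h; rewrite qE h mul0r size_poly0.
  rewrite /g size_scale// size_divp// sf.
  apply: (@leq_trans (size q)); last by rewrite -ltnS.
  by rewrite ltn_subrL /= (ltn_trans _ q_big).
- by rewrite /g hornerZ -f1 mulrC -hornerM -qE.
- move=> z rz'; apply: rootq; move: rz'; rewrite qg rmorphM rootM /= => ->.
  by rewrite orbT.
exists ((1 - a)^-1 :: s).
  move=> x; rewrite inE => /orP[/eqP->|/s0//].
  by rewrite invr_ge0 ltW.
by rewrite big_cons -gE.
Qed.

(** * Mean, variance and exponential moments from the factorization *)

(** These derivatives turn the coefficients [a] into the first two factorial
moments of the variable with generating function [q]. *)
Lemma quadratic_product_derivs (R : numFieldType) (s : seq R) :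
  let q : {poly R} := \prod_(a <- s) ('X + (a / 2) *: ('X - 1) ^+ 2) in
  [/\ q.[1] = 1, q^`().[1] = (size s)%:R &
      q^`()^`().[1] = \sum_(a <- s) a + (size s)%:R ^+ 2 - (size s)%:R].
Proof.
elim: s => [|a s [IH0 IH1 IH2]] /=.
  rewrite !big_nil /= -polyC1 !(derivC, hornerC).
  by split=> //; ring.
rewrite !big_cons; set q := \prod_(_ <- _) _ in IH0 IH1 IH2 *.
set f : {poly R} := 'X + _.
have f1 : f.[1] = 1 by rewrite /f !hornerE /=; ring.
have df : f^`() = 1 + a *: ('X - 1).
  rewrite /f derivD derivX derivZ deriv_exp derivB derivX -polyC1 derivC /=.
  rewrite subr0 expr1 mul1r -scalerMnr scalerMnl; congr (_ + _ *: _).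
  by field.
have df1 : f^`().[1] = 1 by rewrite df !hornerE /=; ring.
have ddf1 : f^`()^`().[1] = a.
  by rewrite df derivD derivZ derivB derivX -polyC1 !derivC !hornerE /=; ring.
clearbody f; split; rewrite !(derivM, derivD, hornerD, hornerM) ?IH0 ?IH1 ?IH2
  ?f1 ?df1 ?ddf1.
- by rewrite mulr1.
- by rewrite !mul1r -natr1 addrC.
- by rewrite -natr1; ring.
Qed.

Lemma comp_Xn_derivs (R : comNzRingType) (r : {poly R}) (n : nat) :
  (r \Po 'X^n)^`().[1] = n%:R * r^`().[1] /\
  (r \Po 'X^n)^`()^`().[1] =
    n%:R ^+ 2 * r^`()^`().[1] + (n%:R ^+ 2 - n%:R) * r^`().[1].
Proof.
have Xn1 k : ('X^k : {poly R}).[1] = 1 by rewrite hornerXn expr1n.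
split.
- by rewrite deriv_comp hornerM horner_comp Xn1 derivXn hornerMn Xn1 mulrC.
- rewrite deriv_comp derivM hornerD !hornerM deriv_comp hornerM !horner_comp.
  rewrite Xn1 derivXn hornerMn Xn1 derivMn derivXn !hornerMn Xn1 /=.
  case: n => [|n]; first by rewrite /= !mulr0n; ring.
  rewrite /= -[n%:R *+ _]mulr_natl -natr1.
  move: (r^`().[1]) (r^`()^`().[1]) (n%:R : R) => y z x; ring.
Qed.

Definition coshB1 (R : realType) (x : R) : R := (expR x + expR (- x)) / 2 - 1.

Section finite_pgf.
Variables (R : realType) (B : nat) (pr : nat -> R).
Let r : {poly R} := \poly_(k < B) pr k.
Let mu : R := \sum_(k < B) k%:R * pr k.
Let v : R := \sum_(k < B) (k%:R - mu) ^+ 2 * pr k.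
Hypothesis r1 : \sum_(k < B) pr k = 1.
Hypothesis root_r :
  forall z : R[i], root (map_poly (real_complex R) r) z -> `|z| = 1.

Let r_horner x : r.[x] = \sum_(k < B) pr k * x ^+ k.
Proof. exact: horner_poly. Qed.

Lemma pgf_mean : r^`().[1] = mu.
Proof.
rewrite /r poly_def linear_sum /= horner_sum; apply: eq_bigr => k _.
by rewrite derivZ derivXn hornerZ hornerMn hornerXn expr1n mulrC.
Qed.

Lemma pgf_variance : r^`()^`().[1] + mu - mu ^+ 2 = v.
Proof.
have -> : r^`()^`().[1] = \sum_(k < B) k%:R * (k%:R - 1) * pr k.
  rewrite /r poly_def !linear_sum /= horner_sum; apply: eq_bigr => k _.
  rewrite !derivZ derivXn derivMn derivXn hornerZ !hornerMn hornerXn expr1n.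
  case: (k : nat) => [|j]; first by rewrite mulr0n mulr0 !mul0r.
  rewrite /= -[j%:R *+ _]mulr_natl -!natr1; set x := (j%:R : R). ring.
have -> : v = \sum_(k < B) (k%:R ^+ 2 * pr k - (2 * mu) * (k%:R * pr k)
   + mu ^+ 2 * pr k) by apply: eq_bigr => k _; ring.
rewrite big_split sumrB /= -!mulr_sumr r1 -/mu.
have -> : \sum_(k < B) k%:R * (k%:R - 1) * pr k =
   \sum_(k < B) k%:R ^+ 2 * pr k - mu.
  by rewrite -sumrB; apply: eq_bigr => k _; ring.
ring.
Qed.

(** The exponent is even so that a real root [z] of the dilated polynomial,
being [1] or [-1], would give the root [z ^+ m.*2 = 1] of [r]. *)
Lemma dilated_pgf_factor (m : nat) : (0 < m)%N ->
  exists2 s : seq R, {in s, forall a, 0 <= a} &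
    r \Po 'X^(m.*2) = \prod_(a <- s) ('X + (a / 2) *: ('X - 1) ^+ 2).
Proof.
move=> m0; apply: unit_nonreal_roots_factor.
  rewrite horner_comp hornerXn expr1n r_horner -[RHS]r1.
  by apply: eq_bigr => k _; rewrite expr1n mulr1.
move=> z; rewrite map_comp_poly map_polyXn root_comp hornerXn => rz.
have z1 : `|z| = 1.
  move/root_r : (rz) => /eqP; rewrite normrX pexpr_eq1// ?double_gt0//.
  by move=> /eqP.
split=> //; apply/negP => /eqP z_real.
move: rz; have -> : z ^+ m.*2 = 1.
  have z2 : z ^+ 2 = 1.
    rewrite -[RHS](expr1n _ 2) -z1 -add_Re2_Im2 z_real.
    case: z z_real {z1} => a b /= ->.
    by rewrite expr0n addr0 rmorphXn.
  by rewrite -mul2n exprM z2 expr1n.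
rewrite -(rmorph1 (real_complex R)) /root horner_map fmorph_eq0 r_horner.
under eq_bigr do rewrite expr1n mulr1.
by rewrite r1 oner_eq0.
Qed.

(** With [h = t / sqrt S], the prefactor [expR (- h * size s)] coming from the
mean cancels the power [x ^ size s] in [\prod (x + (a / 2) (x - 1) ^+ 2)],
where [x = expR h]. *)
Lemma standardized_mgf_factor (m : nat) : (0 < m)%N -> 0 < v ->
  exists s : seq R, [/\ {in s, forall a, 0 <= a},
     \sum_(a <- s) a = (m.*2)%:R ^+ 2 * v &
     forall t : R, let h := t / Num.sqrt (\sum_(a <- s) a) in
       \sum_(k < B) expR (t * ((k%:R - mu) / Num.sqrt v)) * pr k =
       \prod_(a <- s) (1 + a * coshB1 h)].
Proof.
move=> m0 v0; have [s s0 rs] := dilated_pgf_factor m0.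
have [_ q1 q2] := quadratic_product_derivs s; rewrite -rs in q1 q2.
have [r1' r2'] := comp_Xn_derivs r m.*2.
rewrite r1' pgf_mean in q1; rewrite r2' pgf_mean in q2.
have sE : \sum_(a <- s) a = (m.*2)%:R ^+ 2 * v.
  by rewrite -pgf_variance; move: q2; rewrite -q1; set S := \sum_(_ <- _) _; lra.
exists s; split=> // t h.
have M0 : 0 < (m.*2)%:R :> R by rewrite ltr0n double_gt0.
have sv0 : 0 < Num.sqrt v by rewrite sqrtr_gt0.
have hE : h = t / (m.*2%:R * Num.sqrt v).
  by rewrite /h sE sqrtrM ?sqr_ge0// sqrtr_sqr ger0_norm ?ltW.
have x0 : expR h != 0 by rewrite gt_eqF// expR_gt0.
transitivity (expR (- h * (size s)%:R) * (r \Po 'X^(m.*2)).[expR h]).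
  rewrite horner_comp hornerXn r_horner mulr_sumr; apply: eq_bigr => k _.
  rewrite [LHS]mulrC [RHS]mulrCA; congr (_ * _).
  rewrite -!expRM_natr -expRD -q1 hE; congr expR.
  by field; rewrite !gt_eqF.
rewrite rs horner_prod expRM_natr.
have -> : expR (- h) ^+ size s = \prod_(a <- s) expR (- h).
  by rewrite big_const_seq count_predT iter_mulr_1.
rewrite -big_split /=; apply: eq_bigr => a _; rewrite !hornerE /= /coshB1 expRN.
by field.
Qed.
End finite_pgf.

(** * Integer variables with finite range *)

Lemma expectation_bounded_nat d (T : measurableType d) (R : realType)
    (P : probability T R) (X : {RV P >-> nat}) (B : nat) (f : nat -> R) :
  (forall w, (X w < B)%N) ->
  ('E_P[fun w => f (X w)] =
   (\sum_(k < B) f k * fine (P (X @^-1` [set (k : nat)])))%:E)%E.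
Proof.
move=> XB.
have mX k : measurable (X @^-1` [set k]).
  by rewrite -[_ @^-1` _]setTI; exact: (measurable_funP X).
have -> : (fun w => f (X w)) =
    \sum_(k < B) (f k \o* \1_(X @^-1` [set (k : nat)])).
  apply/funext => w; rewrite fct_sumE (bigD1 (Ordinal (XB w)))//= big1.
    by rewrite indicE mem_set// mul1r addr0.
  move=> k kX; rewrite indicE memNset ?mul0r//= => e.
  by move/eqP: kX; apply; apply: val_inj.
rewrite unlock. under eq_integral do rewrite fct_sumE -sumEFin.
rewrite integral_sum//=; last first.
  move=> k; under eq_fun do rewrite mulrC EFinM.
  by apply: integrableZl => //; apply: integrable_indic.
rewrite -sumEFin; apply: eq_bigr => k _.
under eq_integral do rewrite EFinM.
rewrite integralZr//; last exact: integrable_indic.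
by rewrite integral_indic// setIT muleC EFinM fineK// fin_num_measure.
Qed.

Lemma finite_range_bounded (T : Type) (X : T -> nat) :
  finite_set (range X) -> exists B, forall w, (X w < B)%N.
Proof.
move=> /finite_seqP[s sE]; exists (\max_(k <- s) k).+1 => w.
have : range X (X w) by exists w.
by rewrite sE /= ltnS => /leq_bigmax_seq; apply.
Qed.

Lemma unit_root_standardized_mgf d (T : measurableType d) (R : realType)
    (P : probability T R) (X : {RV P >-> nat}) (p : {poly R[i]})
    (V := fine 'V_P[real_of_nat_rv R X]%E) (m : nat) :
  finite_set (range X) ->
  (forall z : R[i], pgf P X z = p.[z]) ->
  (forall z : R[i], root p z -> `|z| = 1) ->
  (0 < 'V_P[real_of_nat_rv R X])%E -> (0 < m)%N ->
  0 < V /\ exists s : seq R, [/\ {in s, forall a, 0 <= a},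
     \sum_(a <- s) a = (m.*2)%:R ^+ 2 * V &
     forall t : R, let h := t / Num.sqrt (\sum_(a <- s) a) in
       ('M_P (standardized P (real_of_nat_rv R X)) t =
       (\prod_(a <- s) (1 + a * coshB1 h))%:E)%E].
Proof.
move=> /finite_range_bounded[B XB] Xp rootp V0 m0.
pose pr k := fine (P (X @^-1` [set k])).
have EX (f : nat -> R) :
    ('E_P[fun w => f (X w)] = (\sum_(k < B) f k * pr k)%:E)%E.
  exact: expectation_bounded_nat.
pose mu : R := \sum_(k < B) k%:R * pr k.
pose v : R := \sum_(k < B) (k%:R - mu) ^+ 2 * pr k.
have muE : fine 'E_P[real_of_nat_rv R X]%E = mu by rewrite EX.
have VE : 'V_P[real_of_nat_rv R X]%E = v%:E.
  rewrite /variance unlock muE.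
  have -> : ((real_of_nat_rv R X \- cst mu) * (real_of_nat_rv R X \- cst mu))%R
    = (fun w => ((X w)%:R - mu) ^+ 2) by apply/funext => w; rewrite expr2.
  by rewrite (EX (fun k => (k%:R - mu) ^+ 2)).
have Vv : V = v by rewrite /V VE.
have v0 : 0 < v by rewrite VE lte_fin in V0.
rewrite Vv; split => //.
have pr1 : \sum_(k < B) pr k = 1.
  have := EX (fun=> 1); rewrite [X in X = _ -> _]expectation_cst => -[->].
  by apply: eq_bigr => k _; rewrite mul1r.
(* [p] takes the same values as the polynomial of coefficients [pr], so both
   have the same roots. *)
have root_pr z :
    root (map_poly (real_complex R) (\poly_(k < B) pr k)) z -> `|z| = 1.
  move=> root_z; apply: rootp; rewrite /root -Xp /pgf /complex_expectation.
  rewrite (EX (fun k => complex.Re (z ^+ k))).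
  rewrite (EX (fun k => complex.Im (z ^+ k))) /=.
  move: root_z; rewrite /root poly_def rmorph_sum horner_sum /=.
  under eq_bigr do rewrite map_polyZ map_polyXn hornerZ hornerXn.
  congr (_ == _).
  set rz := \sum_(i < B) (pr i)%:C%C * z ^+ i.
  rewrite (_ : \sum_(k < B) complex.Re (z ^+ k) * pr k = complex.Re rz).
    rewrite (_ : \sum_(k < B) complex.Im (z ^+ k) * pr k = complex.Im rz).
      by case: rz.
    rewrite /rz (raddf_sum (@complex.Im R : Rcomplex R -> R)).
    apply: eq_bigr => i _; case: (z ^+ i) => x y /=; ring.
  rewrite /rz (raddf_sum (@complex.Re R : Rcomplex R -> R)).
  apply: eq_bigr => i _; case: (z ^+ i) => x y /=; ring.
have [s [s0 sE sM]] := standardized_mgf_factor pr1 root_pr m0 v0.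
exists s; split => // t h; rewrite -sM.
rewrite -(EX (fun k => expR (t * ((k%:R - mu) / Num.sqrt v)))).
rewrite /mmt_gen_fun; congr expectation; apply/funext => w /=.
by rewrite /standardized muE -/V Vv mulrC.
Qed.

(** * Rescaled hyperbolic cosine *)

Definition cosh_scaled (R : realType) (tau t : R) : R :=
  tau * coshB1 (t / Num.sqrt tau).

Lemma cosh_scaled_ge0 (R : realType) (tau t : R) :
  0 <= tau -> 0 <= cosh_scaled tau t.
Proof.
move=> tau0; rewrite /cosh_scaled /coshB1 mulr_ge0// expRN; set x := expR _.
have x0 : 0 < x by exact: expR_gt0.
have -> : (x + x^-1) / 2 - 1 = (x - 1) ^+ 2 / (2 * x) by field; rewrite gt_eqF.
by rewrite divr_ge0 ?sqr_ge0// mulr_ge0 ?ltW.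
Qed.

Lemma cvg_expR_slope (R : realType) :
  (expR h - 1) / h @[h --> (0 : R)^'] --> (1 : R).
Proof.
have D : derivable expR (0 : R) 1.
  exact: (@ex_derive _ _ _ _ _ _ _ (is_derive_expR 0)).
have := D; rewrite /derivable => /cvg_toP; rewrite -[lim _]/('D_1 expR (0 : R)).
have -> : 'D_1 expR (0 : R) = 1.
  by rewrite (@derive_val _ _ _ _ _ _ _ (is_derive_expR 0)) expR0.
move=> /(_ _ erefl); apply: cvg_trans.
apply: near_eq_cvg; near=> h.
by rewrite /= /shift addr0 expR0 -[h *: 1]/(h * 1) mulr1 -[RHS]/(_ * _) mulrC.
Unshelve. all: by end_near. Qed.

(** With [h = t / sqrt tau], the left-hand side is
[(t ^+ 2 / 2) * ((expR h - 1) / h) ^+ 2 * expR (- h)], and [h] tends to [0]. *)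
Lemma cvg_cosh_scaled (R : realType) (tau : nat -> R) (t : R) :
  (forall n, 0 < tau n) -> tau n @[n --> \oo] --> +oo ->
  cosh_scaled (tau n) t @[n --> \oo] --> t ^+ 2 / 2.
Proof.
move=> tau0 tauoo; rewrite /cosh_scaled /coshB1.
have [->|t0] := eqVneq t 0.
  under eq_fun do rewrite mul0r oppr0 expR0.
  rewrite expr0n mul0r (_ : (fun n => _) = cst 0); first exact: cvg_cst.
  by apply/funext => n /=; field.
pose h n := t / Num.sqrt (tau n).
have h0 n : h n != 0 by rewrite mulf_neq0// invr_neq0// gt_eqF// sqrtr_gt0.
have hcvg : h n @[n --> \oo] --> (0 : R).
  rewrite -(mulr0 t); apply: cvgMr.
  have -> : (fun n => (Num.sqrt (tau n))^-1) = (fun n => Num.sqrt (tau n)^-1).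
    by apply/funext => n; rewrite sqrtrV// ltW.
  rewrite -[X in _ --> X](sqrtr0 R); apply: continuous_cvg.
    exact: sqrt_continuous.
  by apply/gtr0_cvgV0 => //; near=> n.
have hdn : h @ \oo --> (0 : R)^'.
  move=> A /=; rewrite /dnbhs /within /= => A0.
  have H : \forall n \near \oo, h n != 0 -> A (h n) by exact: hcvg _ A0.
  by apply: filterS H => n; apply.
have S := cvg_comp _ _ hdn (@cvg_expR_slope R).
have E : expR (- h n) @[n --> \oo] --> (1 : R).
  rewrite -(expR0 R) -oppr0; apply: continuous_cvg; first exact: continuous_expR.
  exact: cvgN.
rewrite (_ : (fun n => _) = (fun n => t ^+ 2 / 2 *
    ((expR (h n) - 1) / h n * ((expR (h n) - 1) / h n)) * expR (- h n))).
  rewrite (_ : nbhs (t ^+ 2 / 2) = nbhs (t ^+ 2 / 2 * (1 * 1) * 1)).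
    2: by rewrite !mulr1.
  exact: cvgM (cvgM (cvg_cst _) (cvgM S S)) E.
apply/funext => n; rewrite -/(h n).
have -> : tau n = t ^+ 2 / (h n) ^+ 2.
  rewrite /h exprMn exprVn sqr_sqrtr ?ltW//.
  by field; rewrite t0 gt_eqF.
by rewrite expRN; field; rewrite h0 gt_eqF// expR_gt0.
Unshelve. all: by end_near. Qed.

(** * Exponential moments under convergence in distribution *)

Section truncated_mgf.
Variables (d : measure_display) (T : measurableType d) (R : realType).
Variables (P : probability T R) (Z : T -> R) (t : R).
Hypothesis mZ : measurable_fun setT Z.

Let mexp c : measurable_fun setT (fun w => expR (c * Z w)).
Proof.
by apply: measurableT_comp => //; apply: measurable_funM => //; exact: measurable_cst.
Qed.

Lemma mmt_gen_funE c : ('M_P Z c = 'E_P[fun w => expR (c * Z w)%R])%E.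
Proof.
by rewrite /mmt_gen_fun; congr expectation; apply/funext => w /=; rewrite mulrC.
Qed.

(** Unlike the exponential, its truncation is bounded, so that convergence in
distribution applies to it. *)
Definition trunc_exp (t A : R) (x : R) : R := Num.min (expR (t * x)) A.

Lemma trunc_exp_ge0 A x : 0 <= A -> 0 <= trunc_exp t A x.
Proof. by move=> A0; rewrite /trunc_exp le_min expR_ge0. Qed.

Lemma continuous_trunc_exp A : continuous (trunc_exp t A).
Proof.
move=> x; apply: (@continuous_min _ _ (fun x => expR (t * x)) (cst A)).
  apply: continuous_comp; last exact: continuous_expR.
  exact: mulrl_continuous.
exact: cst_continuous.
Qed.

Lemma bounded_trunc_exp A : 0 <= A -> bounded_fun (trunc_exp t A).
Proof.
move=> A0; exists A; split; first exact: num_real.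
move=> M AM x _ /=; rewrite ger0_norm ?trunc_exp_ge0//.
by rewrite (le_trans _ (ltW AM))// ge_min lexx orbT.
Qed.

Lemma measurable_trunc_exp A : measurable_fun setT (trunc_exp t A \o Z).
Proof.
apply: measurable_minr => //; exact: measurable_cst.
Qed.

Lemma trunc_exp_le_mgf A : 0 <= A -> ('E_P[trunc_exp t A \o Z] <= 'M_P Z t)%E.
Proof.
move=> A0; rewrite mmt_gen_funE; apply: expectation_le => //.
- exact: measurable_trunc_exp.
- by move=> w; exact: trunc_exp_ge0.
- by apply: aeW => w; rewrite /trunc_exp /= ge_min lexx.
Qed.

(** Where [x = expR (t * Z w)] exceeds [A], it is at most [x ^+ 2 / A]; so a
bound on the second exponential moment controls the truncation error. *)
Lemma mgf_le_trunc_exp A : 0 < A ->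
  ('M_P Z t <= 'E_P[trunc_exp t A \o Z] + A^-1%:E * 'M_P Z (2 * t))%E.
Proof.
move=> A0.
have mA : measurable_fun setT (trunc_exp t A \o Z) by exact: measurable_trunc_exp.
have me2 : measurable_fun setT (fun w => A^-1 * expR (2 * t * Z w)).
  by apply: measurable_funM => //; exact: measurable_cst.
apply: (@le_trans _ _ ('E_P[fun w => ((trunc_exp t A \o Z) w + A^-1 * expR (2 * t * Z w))%R])%E).
  rewrite mmt_gen_funE; apply: expectation_le => //.
  - exact: measurable_funD.
  - by move=> w; rewrite addr_ge0 ?trunc_exp_ge0 ?ltW// mulr_gt0 ?invr_gt0 ?expR_gt0.
  - apply: aeW => w /=; rewrite /trunc_exp; set x := expR _.
    have -> : expR (2 * t * Z w) = x ^+ 2 by rewrite -expRM_natl; congr expR; ring.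
    have x0 : 0 < x by exact: expR_gt0.
    have [xA|Ax] := leP x A; first by rewrite lerDl mulr_ge0 ?invr_ge0 ?ltW// exprn_gt0.
    apply: ler_wpDl; first exact: ltW.
    rewrite [leRHS]mulrC ler_pdivlMr// expr2 ler_pM2l//.
    exact: ltW.
rewrite mmt_gen_funE unlock.
under eq_integral do rewrite EFinD.
rewrite ge0_integralD//.
- under [X in (_ + X <= _)%E]eq_integral do rewrite EFinM.
  rewrite ge0_integralZl//; last by rewrite lee_fin invr_ge0 ltW.
  exact/measurable_EFinP.
- by move=> w _; rewrite lee_fin trunc_exp_ge0 ?ltW.
- exact/measurable_EFinP.
- by move=> w _; rewrite lee_fin mulr_ge0 ?expR_ge0 ?invr_ge0 ?ltW.
- exact/measurable_EFinP.
Qed.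

Lemma cvg_trunc_exp_mgf :
  ('E_P[trunc_exp t n.+1%:R \o Z] @[n --> \oo] --> 'M_P Z t)%E.
Proof.
rewrite mmt_gen_funE unlock.
rewrite (_ : (\int[P]_w _)%E = (\int[P]_w limn (fun n => (trunc_exp t n.+1%:R (Z w))%:E))%E).
  apply: cvg_monotone_convergence => //.
  - by move=> n; apply/measurable_EFinP; exact: measurable_trunc_exp.
  - by move=> n w _; rewrite lee_fin trunc_exp_ge0.
  - move=> w _ m n mn; rewrite lee_fin /trunc_exp le_min !ge_min lexx/=.
    by rewrite ler_nat ltnS mn orbT.
apply: eq_integral => w _; apply/esym/cvg_lim => //.
apply: cvg_near_cst; near=> n.
congr EFin; rewrite /trunc_exp; apply/min_idPl.
have : expR (t * Z w) <= n%:R by near: n; exact: nbhs_infty_ger.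
by move=> /le_trans; apply; rewrite ler_nat.
Unshelve. all: by end_near. Qed.

End truncated_mgf.

(** The bound [M2 n <= C] makes the truncation error at level [A] at most
[C / A] eventually along [F], so truncation and limit can be exchanged.  An
arbitrary filter finer than [\oo] is allowed in order to use limits along an
ultrafilter. *)
Lemma mgf_limit (R : realType) (d : nat -> measure_display)
    (T : forall n, measurableType (d n)) (P : forall n, probability (T n) R)
    (Z : forall n, T n -> R) (d' : measure_display) (T' : measurableType d')
    (P' : probability T' R) (Y : {RV P' >-> R})
    (F : set_system nat) (FF : ProperFilter F) (t C L : R) (M M2 : nat -> R) :
  F --> \oo -> (forall n, measurable_fun setT (Z n)) ->
  cvg_in_distribution P Z P' Y ->
  (forall n, ('M_(P n) (Z n) t = (M n)%:E)%E) ->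
  (forall n, ('M_(P n) (Z n) (2 * t) = (M2 n)%:E)%E) ->
  (\forall n \near F, M2 n <= C) ->
  M n @[n --> F] --> L ->
  ('M_P' Y t = L%:E)%E.
Proof.
move=> Foo mZ ZY MZ MZ2 M2C ML.
have mY : measurable_fun setT Y by exact: measurable_funP.
pose e n := 'E_P'[trunc_exp t n.+1%:R \o Y]%E.
have e_fin n : e n \is a fin_num.
  rewrite ge0_fin_numE; last first.
    by apply: expectation_ge0 => w; rewrite trunc_exp_ge0.
  apply: (@le_lt_trans _ _ 'E_P'[cst n.+1%:R]%E); last first.
    by rewrite expectation_cst ltry.
  apply: expectation_le => //.
  - exact: measurable_trunc_exp.
  - by move=> w; rewrite trunc_exp_ge0.
  - by apply: aeW => w; rewrite /= /trunc_exp ge_min lexx orbT.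
have eL n : ((L - n.+1%:R^-1 * C)%:E <= e n <= L%:E)%E.
  have f_cvg := ZY _ (@continuous_trunc_exp R t n.+1%:R)
    (@bounded_trunc_exp R t _ (ler0n R n.+1)).
  have {}f_cvg : 'E_(P k)[trunc_exp t n.+1%:R \o Z k]%E @[k --> F] --> e n.
    exact: (cvg_trans (cvg_app _ Foo) f_cvg).
  rewrite -(fineK (e_fin n)) in f_cvg *; rewrite !lee_fin.
  have g_cvg : fine ('E_(P k)[trunc_exp t n.+1%:R \o Z k])%E @[k --> F] --> fine (e n).
    exact: fine_cvg f_cvg.
  have bnd k : M k - n.+1%:R^-1 * M2 k <= fine 'E_(P k)[trunc_exp t n.+1%:R \o Z k]%E <= M k.
    have := @trunc_exp_le_mgf _ _ _ (P k) (Z k) t (mZ k) n.+1%:R (ler0n _ _).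
    have := @mgf_le_trunc_exp _ _ _ (P k) (Z k) t (mZ k) n.+1%:R (ltr0Sn _ _).
    have : (0 <= 'E_(P k)[trunc_exp t n.+1%:R \o Z k])%E.
      by apply: expectation_ge0 => w; rewrite trunc_exp_ge0.
    rewrite MZ MZ2; case: ('E_(P k)[_])%E => [x| |]//= _.
    by rewrite -EFinM -EFinD !lee_fin lerBlDr => -> ->.
  apply/andP; split.
    have h_cvg : M k - n.+1%:R^-1 * C @[k --> F] --> L - n.+1%:R^-1 * C.
      by apply: cvgB => //; exact: cvg_cst.
    apply: (@ler_cvg_to nat F FF R _ _ _ _ h_cvg g_cvg).
    near=> k; rewrite (le_trans _ (proj1 (andP (bnd k))))// lerD2l lerN2.
    by rewrite ler_wpM2l ?invr_ge0//; near: k.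
  apply: (@ler_cvg_to nat F FF R _ _ _ _ g_cvg ML); near=> k.
  by case/andP: (bnd k).
have eM : e n @[n --> \oo] --> 'M_P' Y t by exact: cvg_trunc_exp_mgf.
apply: (cvg_unique _ eM) => //.
apply: (@squeeze_cvge _ _ _ _ (fun n => (L - n.+1%:R^-1 * C)%:E) _ (cst L%:E)).
- by near=> n; exact: eL.
- apply: cvg_EFin; first by near=> n.
  rewrite -[X in _ --> X]subr0 -[X in _ --> _ - X](mul0r C).
  by apply: cvgB; [exact: cvg_cst|apply: cvgMl; exact: cvg_harmonic].
- exact: cvg_cst.
Unshelve. all: by end_near. Qed.

(** * Products of weights summing to one *)

(** The reverse of [1 + y <= expR y], with a loss that disappears as the bound
[c] on [y] tends to [0]. *)
Lemma expR_le_1Dx (R : realType) (c y : R) : 0 <= y <= c ->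
  expR (y / (1 + c)) <= 1 + y.
Proof.
move=> /andP[y0 yc].
have y1 : 0 < 1 + y by lra.
apply: (@le_trans _ _ (expR (y / (1 + y)))).
  by rewrite ler_expR ler_wpM2l// lef_pV2 ?posrE//; lra.
rewrite -[leLHS]invrK -expRN -[leRHS]invrK lef_pV2 ?posrE ?invr_gt0 ?expR_gt0//.
apply: le_trans (expR_ge1Dx _).
by rewrite le_eqVlt; apply/orP; left; apply/eqP; field; rewrite gt_eqF.
Qed.

Section product_sandwich.
Variables (R : realType) (b : nat -> R) (N : nat) (w : R).
Hypothesis b0 : forall k, 0 <= b k.
Hypothesis bk : forall k, b k <= k.+1%:R^-1.
Hypothesis bN : forall k, (N <= k)%N -> b k = 0.
Hypothesis b1 : \sum_(0 <= k < N) b k = 1.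
Hypothesis w0 : 0 <= w.

Let sum_tail K : \sum_(K <= k < K + N) b k = 1 - \sum_(0 <= k < K) b k.
Proof.
have KN : \sum_(0 <= k < K + N) b k = 1.
  rewrite (@big_cat_nat _ _ _ N) ?leq_addl//= b1 big1_seq ?addr0//.
  by move=> k; rewrite mem_index_iota => /andP[_ /andP[Nk _]]; exact: bN.
by rewrite -KN (@big_cat_nat _ _ _ K 0%N (K + N)%N) ?leq_addr//= addrAC subrr add0r.
Qed.

Let prod_tail K : \prod_(0 <= k < N) (1 + b k * w) =
  \prod_(0 <= k < K) (1 + b k * w) * \prod_(K <= k < K + N) (1 + b k * w).
Proof.
rewrite -big_cat_nat ?leq_addr//=.
rewrite [RHS](@big_cat_nat _ _ _ N) ?leq_addl//= [X in _ = _ * X]big1_seq ?mulr1//.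
move=> k; rewrite mem_index_iota => /andP[_ /andP[Nk _]].
by rewrite bN// mul0r addr0.
Qed.

Let bw0 k : 0 <= b k * w. Proof. exact: mulr_ge0. Qed.

Lemma prod_head_ge0 K : 0 <= \prod_(0 <= k < K) (1 + b k * w).
Proof. by apply: prodr_ge0 => k _; rewrite addr_ge0. Qed.

(** The head of the product is kept and the tail is replaced by the exponential
of its mass, which bounds it by [1 + y <= expR y]. *)
Lemma prod_le_head_expR K : \prod_(0 <= k < N) (1 + b k * w) <=
  \prod_(0 <= k < K) (1 + b k * w) * expR ((1 - \sum_(0 <= k < K) b k) * w).
Proof.
rewrite (prod_tail K) ler_wpM2l ?prod_head_ge0// -sum_tail mulr_suml expR_sum.
by apply: ler_prod => k _; rewrite addr_ge0//= expR_ge1Dx.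
Qed.

(** Beyond [K] every [b k * w] is at most [w / K.+1], so [expR_le_1Dx] applies
to the whole tail with the same constant. *)
Lemma head_expR_le_prod K :
  \prod_(0 <= k < K) (1 + b k * w) *
    expR ((1 - \sum_(0 <= k < K) b k) * w / (1 + w / K.+1%:R)) <=
  \prod_(0 <= k < N) (1 + b k * w).
Proof.
rewrite (prod_tail K) ler_wpM2l ?prod_head_ge0// -sum_tail !mulr_suml expR_sum.
rewrite !big_nat; apply: ler_prod => k /andP[Kk _]; rewrite expR_ge0/=.
apply: expR_le_1Dx; rewrite bw0/= mulrC ler_wpM2l//.
by rewrite (le_trans (bk k))// lef_pV2 ?posrE// ler_nat ltnS.
Qed.

End product_sandwich.

Section limit_product.
Variables (R : realType) (F : set_system nat) (FF : ProperFilter F).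
Variables (b : nat -> nat -> R) (N : nat -> nat) (beta : nat -> R).
Hypothesis b0 : forall n k, 0 <= b n k.
Hypothesis bk : forall n k, b n k <= k.+1%:R^-1.
Hypothesis bN : forall n k, (N n <= k)%N -> b n k = 0.
Hypothesis b1 : forall n, \sum_(0 <= k < N n) b n k = 1.
Hypothesis b_beta : forall k, b n k @[n --> F] --> beta k.

Lemma beta_ge0 k : 0 <= beta k.
Proof.
by apply: (cvgr_to_ge (@b_beta k)); near=> n.
Unshelve. all: by end_near. Qed.

Let cvg_sum K : \sum_(0 <= k < K) b n k @[n --> F] --> \sum_(0 <= k < K) beta k.
Proof.
elim: K => [|K IH].
  by under eq_fun do rewrite big_geq//; rewrite big_geq//; exact: cvg_cst.
by under eq_fun do rewrite big_nat_recr//=; rewrite big_nat_recr//=; exact: cvgD.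
Qed.

Lemma sum_beta_le1 K : \sum_(0 <= k < K) beta k <= 1.
Proof.
apply: (cvgr_to_le (@cvg_sum K)); near=> n.
have [KN|/ltnW NK] := leqP K (N n).
  rewrite -(b1 n) [leRHS](@big_cat_nat _ _ _ K)//= lerDl.
  by apply: sumr_ge0.
rewrite (@big_cat_nat _ _ _ (N n))//= b1 big1_seq ?addr0//.
by move=> k; rewrite mem_index_iota => /andP[_ /andP[Nk _]]; exact: bN.
Unshelve. all: by end_near. Qed.

Lemma cvg_sum_beta : cvgn (fun K => \sum_(0 <= k < K) beta k).
Proof.
apply: nondecreasing_is_cvgn.
  apply/nondecreasing_seqP => K; rewrite big_nat_recr//= lerDl; exact: beta_ge0.
by exists 1 => _ [K _ <-]; exact: sum_beta_le1.
Qed.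

Variables (u : nat -> R) (w L : R).
Hypothesis u0 : forall n, 0 <= u n.
Hypothesis uw : u n @[n --> F] --> w.
Hypothesis prodL : \prod_(0 <= k < N n) (1 + b n k * u n) @[n --> F] --> L.

Let w0 : 0 <= w.
Proof.
by apply: (cvgr_to_ge uw); near=> n.
Unshelve. all: by end_near. Qed.

Let cvg_prod K : \prod_(0 <= k < K) (1 + b n k * u n) @[n --> F] -->
  \prod_(0 <= k < K) (1 + beta k * w).
Proof.
elim: K => [|K IH].
  by under eq_fun do rewrite big_geq//; rewrite big_geq//; exact: cvg_cst.
under eq_fun do rewrite big_nat_recr//=; rewrite big_nat_recr//=.
by apply: cvgM => //; apply: cvgD; [exact: cvg_cst|exact: cvgM].
Qed.

Let tail K := 1 - \sum_(0 <= k < K) beta k.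

Let limit_le K : L <= \prod_(0 <= k < K) (1 + beta k * w) * expR (tail K * w).
Proof.
have h : \prod_(0 <= k < K) (1 + b n k * u n) *
    expR ((1 - \sum_(0 <= k < K) b n k) * u n) @[n --> F] -->
    \prod_(0 <= k < K) (1 + beta k * w) * expR (tail K * w).
  apply: cvgM => //; apply: continuous_cvg; first exact: continuous_expR.
  by apply: cvgM => //; apply: cvgB => //; exact: cvg_cst.
apply: (@ler_cvg_to nat F FF R _ _ _ _ prodL h); near=> n.
apply: prod_le_head_expR => //; exact: bN.
Unshelve. all: by end_near. Qed.

Let le_limit K : \prod_(0 <= k < K) (1 + beta k * w) *
  expR (tail K * w / (1 + w / K.+1%:R)) <= L.
Proof.
have h : \prod_(0 <= k < K) (1 + b n k * u n) *
    expR ((1 - \sum_(0 <= k < K) b n k) * u n / (1 + u n / K.+1%:R)) @[n --> F] -->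
    \prod_(0 <= k < K) (1 + beta k * w) * expR (tail K * w / (1 + w / K.+1%:R)).
  apply: cvgM => //; apply: continuous_cvg; first exact: continuous_expR.
  apply: cvgM.
    by apply: cvgM => //; apply: cvgB => //; exact: cvg_cst.
  apply: cvgV; first by rewrite gt_eqF// ltr_pwDl// divr_ge0.
  by apply: cvgD; [exact: cvg_cst|apply: cvgMl].
apply: (@ler_cvg_to nat F FF R _ _ _ _ h prodL); near=> n.
apply: head_expR_le_prod => //; exact: bN.
Unshelve. all: by end_near. Qed.

(** The limit in [n] of the two bounds on the product cut at [K] gives bounds on
[L] whose quotient tends to [1] as [K] grows.  The mass [1 - sum of beta] that
is lost in the limit comes from weights that tend to [0] uniformly, and it
survives as an exponential. *)
Lemma limit_product :
  let prods K := \prod_(0 <= k < K) (1 + beta k * w) in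
  cvgn prods /\
  L = expR ((1 - limn (fun K => \sum_(0 <= k < K) beta k)) * w) * limn prods.
Proof.
move=> prods.
have bw k : 0 <= beta k * w by rewrite mulr_ge0// beta_ge0.
have prods_ge0 K : 0 <= prods K by apply: prodr_ge0 => k _; rewrite addr_ge0.
have tail0 K : 0 <= tail K by rewrite subr_ge0 sum_beta_le1.
have prods_cvg : cvgn prods.
  apply: nondecreasing_is_cvgn.
    apply/nondecreasing_seqP => K; rewrite /prods big_nat_recr//=.
    by rewrite ler_peMr ?prods_ge0// lerDl.
  exists L => _ [K _ <-]; apply: le_trans (le_limit K).
  rewrite ler_peMr ?prods_ge0// -[leLHS](expR0 R) ler_expR.
  by rewrite divr_ge0 ?mulr_ge0// addr_ge0// divr_ge0.
split=> //; set S := limn _.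
have tail_cvg : tail K @[K --> \oo] --> 1 - S.
  by apply: cvgB; [exact: cvg_cst|exact: cvg_sum_beta].
have up : prods K * expR (tail K * w) @[K --> \oo] --> limn prods * expR ((1 - S) * w).
  apply: cvgM => //; apply: continuous_cvg; first exact: continuous_expR.
  exact: cvgMl.
have lo : prods K * expR (tail K * w / (1 + w / K.+1%:R)) @[K --> \oo] -->
    limn prods * expR ((1 - S) * w).
  apply: cvgM => //; apply: continuous_cvg; first exact: continuous_expR.
  rewrite -[X in _ --> X]mulr1; apply: cvgM; first exact: cvgMl.
  rewrite -[X in _ --> X]invr1; apply: cvgV; first exact: oner_neq0.
  rewrite -[X in _ --> X]addr0; apply: cvgD; first exact: cvg_cst.
  rewrite -[X in _ --> X](mulr0 w); apply: cvgMr; exact: cvg_harmonic.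
rewrite mulrC; apply/eqP; rewrite eq_le; apply/andP; split.
  by apply: (cvgr_to_ge up); near=> K; exact: limit_le.
by apply: (cvgr_to_le lo); near=> K; exact: le_limit.
Unshelve. all: by end_near. Qed.

End limit_product.

(** Passing to an ultrafilter replaces the extraction of subsequences: it makes
all bounded sequences converge at once. *)
Lemma ultrafilter_bounded_cvg (R : realType) (I : Type) (F : set_system I)
    (u : I -> R) (m M : R) : UltraFilter F -> (\forall n \near F, m <= u n <= M) ->
  exists l : R, u n @[n --> F] --> l.
Proof.
move=> FU uM; have FF : ProperFilter F by exact: ultra_proper.
have [l [_ l_cluster]] : `[m, M] `&` cluster (u @ F) !=set0.
  apply: (@segment_compact _ m M (u @ F)).
  by apply: filterS uM => n /=; rewrite in_itv.
exists l => B lB; have [//|FB] := in_ultra_setVsetC (u @^-1` B) FU.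
by have [x [/= nBx Bx]] := l_cluster (~` B) B FB lB.
Qed.

(** Sorting makes the weight of index [k] the smallest of [k.+1] weights whose
sum is at most [1]; this gives the bound [k.+1%:R^-1], which keeps the tails
of the products uniformly small. *)
Lemma decreasing_weights (R : realType) (s : seq R) (S := \sum_(a <- s) a) :
  {in s, forall a, 0 <= a} -> 0 < S ->
  exists b : nat -> R, [/\ forall k, 0 <= b k, forall k, b k <= k.+1%:R^-1,
    forall k, (size s <= k)%N -> b k = 0, \sum_(0 <= k < size s) b k = 1 &
    forall c, \prod_(a <- s) (1 + a * c) =
              \prod_(0 <= k < size s) (1 + b k * (S * c))].
Proof.
move=> s0 S0; pose s' := sort (fun x y => y <= x) s.
have ps : perm_eq s' s by rewrite perm_sort.
have szs : size s' = size s by rewrite size_sort.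
have s'0 k : 0 <= s'`_k.
  have [ks|ks] := ltnP k (size s'); last by rewrite nth_default.
  by apply: s0; rewrite -(perm_mem ps) mem_nth.
have s'S : \sum_(0 <= k < size s) s'`_k = S.
  by rewrite -szs -(big_nth 0 xpredT id) (perm_big _ ps).
have S_neq0 : S != 0 by rewrite gt_eqF.
exists (fun k => s'`_k / S); split.
- by move=> k; rewrite divr_ge0// ltW.
- move=> k; have [ks|ks] := ltnP k (size s); last first.
    by rewrite nth_default ?szs// mul0r invr_ge0.
  rewrite ler_pdivrMr// mulrC ler_pdivlMr// -s'S.
  rewrite (@big_cat_nat _ _ _ k.+1)//= -[leLHS]addr0 lerD//; last exact: sumr_ge0.
  rewrite mulr_natr -[X in _ *+ X]subn0 -sumr_const_nat !big_nat.
  apply: ler_sum => i /andP[_ ik].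
  apply: (@sorted_leq_nth _ (fun x y : R => y <= x)) => //.
  + by move=> x y z xy yz; exact: le_trans xy.
  + by apply: sort_sorted => x y; exact: le_total.
  + by rewrite inE szs (leq_ltn_trans _ ks).
  + by rewrite inE szs.
- by move=> k ks; rewrite nth_default ?szs// mul0r.
- by rewrite -mulr_suml s'S divff.
- move=> c; rewrite -(perm_big _ ps) (big_nth 0) szs; apply: eq_bigr => k _.
  by field.
Qed.

(** * The limit law *)

(** The dilation factor [m] is chosen with [m >= n.+1 / V], so that the variance
[tau] of the dilated variable is at least [n.+1]. *)
Lemma standardized_mgf_product d (T : measurableType d) (R : realType)
    (P : probability T R) (X : {RV P >-> nat}) (p : {poly R[i]}) (n : nat) :
  finite_set (range X) ->
  (forall z : R[i], pgf P X z = p.[z]) ->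
  (forall z : R[i], root p z -> `|z| = 1) ->
  (0 < 'V_P[real_of_nat_rv R X])%E ->
  exists x : (nat -> R) * nat * R, let: (b, N, tau) := x in
  [/\ forall k, 0 <= b k, forall k, b k <= k.+1%:R^-1,
    forall k, (N <= k)%N -> b k = 0, \sum_(0 <= k < N) b k = 1 &
    n.+1%:R <= tau /\
    forall t : R, ('M_P (standardized P (real_of_nat_rv R X)) t =
      (\prod_(0 <= k < N) (1 + b k * cosh_scaled tau t))%:E)%E].
Proof.
move=> Xfin Xp rootp V0; pose V := fine 'V_P[real_of_nat_rv R X]%E.
have [Vpos _] := unit_root_standardized_mgf Xfin Xp rootp V0 (ltn0Sn 0).
pose m := Num.truncn (n.+1%:R / V).
have [_ [s [s0 sE sM]]] := unit_root_standardized_mgf Xfin Xp rootp V0 (ltn0Sn m).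
have nS : n.+1%:R <= \sum_(a <- s) a.
  rewrite sE -ler_pdivrMr//; apply: (@le_trans _ _ m.+1%:R).
    by apply/ltW; exact: truncnS_gt.
  rewrite -natrX ler_nat -mul2n expnMn -[leqLHS]mul1n leq_mul// -mulnn leq_pmulr//.
have S0 : 0 < \sum_(a <- s) a by apply: lt_le_trans nS.
have [b [b0 bk bN b1 bprod]] := decreasing_weights s0 S0.
exists (b, size s, \sum_(a <- s) a); split => //; split => // t.
by rewrite sM bprod.
Qed.

Lemma measurable_standardized d (T : measurableType d) (R : realType)
    (P : probability T R) (X : {RV P >-> nat}) :
  measurable_fun setT (standardized P (real_of_nat_rv R X)).
Proof.
move=> _ A _; rewrite setTI -[_ @^-1` A]setTI.
pose g (k : nat) : R :=
  (k%:R - fine 'E_P[real_of_nat_rv R X]%E) /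
  Num.sqrt (fine 'V_P[real_of_nat_rv R X]%E).
exact: (measurable_funP X measurableT (g @^-1` A) I).
Qed.

Theorem theorem1p2 (R : realType)
    (d : nat -> measure_display) (T : forall n, measurableType (d n))
    (P : forall n, probability (T n) R)
    (X : forall n, {RV (P n) >-> nat})
    (p : nat -> {poly R[i]})
    (X_finite : forall n, finite_set (range (X n)))
    (X_pgf : forall n (z : R[i]), pgf (P n) (X n) z = (p n).[z])
    (p_nonconstant : forall n, (1 < size (p n))%N)
    (p_unit_roots : forall n (z : R[i]), root (p n) z -> `|z| = 1)
    (X_variance : forall n, (0 < 'V_(P n)[real_of_nat_rv R (X n)])%E)
    (d' : measure_display) (T' : measurableType d') (P' : probability T' R)
    (Y : {RV P' >-> R})
    (X_cvg : cvg_in_distribution P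
       (fun n => standardized (P n) (real_of_nat_rv R (X n))) P' Y) :
  exists (q : R) (q_ : nat -> R),
    [/\ 0 <= q,
        forall k, (1 <= k)%N -> 0 <= q_ k,
        (q%:E + \sum_(1 <= k <oo) (q_ k)%:E = 1)%E &
        forall s : R,
          let prods n := \prod_(1 <= k < n) (1 + q_ k / 2 * s ^+ 2) in
          cvgn prods /\
          ('M_P' Y s)%E = (expR (q * s ^+ 2 / 2) * limn prods)%:E].
Proof.
have /choice[x Hx] : forall n, _ := fun n => standardized_mgf_product n
  (X_finite n) (X_pgf n) (p_unit_roots n) (X_variance n).
pose b n := (x n).1.1; pose N n := (x n).1.2; pose tau n := (x n).2.
have {}Hx n : [/\ forall k, 0 <= b n k, forall k, b n k <= k.+1%:R^-1,
    forall k, (N n <= k)%N -> b n k = 0, \sum_(0 <= k < N n) b n k = 1 &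
    n.+1%:R <= tau n /\
    forall t : R, ('M_(P n) (standardized (P n) (real_of_nat_rv R (X n))) t =
      (\prod_(0 <= k < N n) (1 + b n k * cosh_scaled (tau n) t))%:E)%E].
  by move: (Hx n); rewrite /b /N /tau; case: (x n) => -[].
have b0 n k : 0 <= b n k by case: (Hx n).
have bk n k : b n k <= k.+1%:R^-1 by case: (Hx n).
have bN n k : (N n <= k)%N -> b n k = 0 by case: (Hx n) => _ _ /(_ k).
have b1 n : \sum_(0 <= k < N n) b n k = 1 by case: (Hx n).
have tau_ge n : n.+1%:R <= tau n by case: (Hx n) => _ _ _ _ [].
have tau0 n : 0 < tau n by apply: lt_le_trans (tau_ge n).
pose M t n := \prod_(0 <= k < N n) (1 + b n k * cosh_scaled (tau n) t).
have ME t n :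
    ('M_(P n) (standardized (P n) (real_of_nat_rv R (X n))) t = (M t n)%:E)%E.
  by case: (Hx n) => _ _ _ _ [].
have tau_oo : tau n @[n --> \oo] --> +oo.
  apply/cvgryPge => A; near=> n; apply: le_trans (tau_ge n).
  have : A <= n%:R by near: n; exact: nbhs_infty_ger.
  by move=> /le_trans; apply; rewrite ler_nat.
have w_cvg t : cosh_scaled (tau n) t @[n --> \oo] --> t ^+ 2 / 2.
  exact: cvg_cosh_scaled.
have w0 t n : 0 <= cosh_scaled (tau n) t by rewrite cosh_scaled_ge0 ?ltW.
have M_bound t : \forall n \near \oo, 0 <= M t n <= expR (t ^+ 2 / 2 + 1).
  have : \forall n \near \oo, cosh_scaled (tau n) t <= t ^+ 2 / 2 + 1.
    by apply: (cvgr_le _ (w_cvg t)); rewrite ltrDl.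
  apply: filterS => n wn; rewrite prod_head_ge0//=.
  apply: le_trans (prod_le_head_expR (b0 n) (bN n) (b1 n) (w0 t n) 0) _.
  by rewrite !big_geq// mul1r subr0 mul1r ler_expR.
(* All limits below are taken along one ultrafilter, which depends neither on
   the index [k] nor on the argument [s]. *)
have [F [FU Foo]] := @ultraFilterLemma nat \oo _.
have FF : ProperFilter F by exact: ultra_proper.
have /choice[beta b_beta] : forall k, exists l : R, b n k @[n --> F] --> l.
  move=> k; apply: (ultrafilter_bounded_cvg FU (m := 0) (M := k.+1%:R^-1)).
  by near=> n; rewrite b0 bk.
have beta0 k : 0 <= beta k by exact: (beta_ge0 FF b0 b_beta).
pose q := 1 - limn (fun K => \sum_(0 <= k < K) beta k).
have sum_cvg := cvg_sum_beta FF b0 bN b1 b_beta.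
exists q, (fun k => beta k.-1); split.
- rewrite subr_ge0; apply: limr_le => //; near=> K.
  exact: (sum_beta_le1 FF b0 bN b1 b_beta).
- by move=> k _; exact: beta0.
- have -> : (\sum_(1 <= k <oo) (beta k.-1)%:E =
      (limn (fun K => \sum_(0 <= k < K) beta k))%:E)%E.
    apply: cvg_lim => //; rewrite -cvg_shiftS.
    under eq_fun do rewrite big_add1 /= sumEFin.
    by apply: cvg_EFin; [near=> n|].
  by rewrite -EFinD /q subrK.
move=> s prods.
have [L ML] : exists L : R, M s n @[n --> F] --> L.
  apply: (ultrafilter_bounded_cvg FU (m := 0)); exact: Foo (M_bound s).
have ws : cosh_scaled (tau n) s @[n --> F] --> s ^+ 2 / 2.
  exact: cvg_trans (cvg_app _ Foo) (w_cvg s).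
have [prods_cvg LE] := limit_product FF b0 bk bN b1 b_beta (w0 s) ws ML.
(* The product is indexed from [1], the limits [beta] from [0]. *)
have prodsS : (fun n => prods n.+1) =
    (fun K => \prod_(0 <= k < K) (1 + beta k * (s ^+ 2 / 2))).
  apply/funext => n; rewrite /prods big_add1 /=; apply: eq_bigr => k _; ring.
have prods_lim : prods @ \oo -->
    limn (fun K => \prod_(0 <= k < K) (1 + beta k * (s ^+ 2 / 2))).
  by rewrite -cvg_shiftS prodsS.
split; first by apply/cvg_ex; eexists; exact: prods_lim.
rewrite (cvg_lim _ prods_lim)// -mulrA -LE.
apply: (@mgf_limit _ _ _ P _ _ _ P' Y F FF s (expR ((2 * s) ^+ 2 / 2 + 1)) L
  (M s) (M (2 * s))).
- exact: Foo.
- by move=> n; exact: measurable_standardized.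
- exact: X_cvg.
- exact: ME.
- exact: ME.
- by apply: (Foo); apply: filterS (M_bound (2 * s)) => n /andP[].
- exact: ML.
Unshelve. all: by end_near. Qed.
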